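(* For every positive integer $n$, there is a generic convex drawing of the complete graph $K_n$ that does not contain any $k$-face with $k \geq 6$.
   Context: A rectilinear drawing $D$ of $K_n$ represents the vertices of $K_n$ by $n$ distinct points in the plane $\mathbb{R}^2$, no three of which lie on a common line, and represents each edge by the line segment connecting the points representing its end-vertices. The drawing $D$ is convex if the points representing the vertices are in convex position. A heavy crossing in $D$ is a common interior point of at least three edges (segments) of $D$ where they properly cross; $D$ is generic if it has no heavy crossings. Identify $D$ with the union of its points and segments. A face of $D$ is a non-empty connected component of $\mathbb{R}^2 \setminus D$. Exactly one face is unbounded, and every bounded face is (the interior of) a convex polygon; the size of a bounded face is the number of vertices (corners) of this polygon. A bounded face of size $k$ is called a $k$-face of $D$. *)

(* Defs.v *)
From HB Require Import structures.
From mathcomp Require Import all_boot all_order all_algebra.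
From mathcomp Require Import all_classical all_reals all_analysis.

Set Implicit Arguments.
Unset Strict Implicit.
Unset Printing Implicit Defensive.

Import Order.TTheory GRing.Theory Num.Theory.
Import numFieldNormedType.Exports.

Local Open Scope classical_set_scope.
Local Open Scope ring_scope.

(* The plane is 'rV[R]_2, whose norm is the sup norm; it
   induces the usual topology and the usual bounded sets. *)

Section Plane.
Variable R : realType.
Implicit Types x y : 'rV[R]_2.

Definition segment x y : set 'rV[R]_2 :=
  [set (1 - t) *: x + t *: y | t in `[0, 1]].

Definition open_segment x y : set 'rV[R]_2 :=
  [set (1 - t) *: x + t *: y | t in `]0, 1[].

Definition line (x d : 'rV[R]_2) : set 'rV[R]_2 := range (fun t : R => x + t *: d).

Definition convex_hull (A : set 'rV[R]_2) : set 'rV[R]_2 :=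
  smallest (@convex_set R 'rV[R]_2) A.

(* In particular the points are pairwise distinct. *)
Definition convex_position (k : nat) (c : 'I_k -> 'rV[R]_2) : Prop :=
  forall i, ~ convex_hull (c @` [set j | j != i]) (c i).

End Plane.

(* The edges of K_n, each one encoded once as an ordered pair. *)
Definition edges (n : nat) : {set 'I_n * 'I_n} :=
  [set e : 'I_n * 'I_n | (e.1 < e.2)%N]%SET.

Section Drawing.
Variables (R : realType) (n : nat) (p : 'I_n -> 'rV[R]_2).

Definition rectilinear_drawing : Prop :=
  injective p /\
  forall i j k, i != j -> j != k -> i != k ->
    ~ exists x d : 'rV[R]_2,
        [/\ d != 0, line x d (p i), line x d (p j) & line x d (p k)].

Definition edge_segment (e : 'I_n * 'I_n) : set 'rV[R]_2 :=
  segment (p e.1) (p e.2).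

Definition edge_interior (e : 'I_n * 'I_n) : set 'rV[R]_2 :=
  open_segment (p e.1) (p e.2).

(* Two line segments that share a relative interior point cross properly there
   exactly when they do not overlap along a line. *)
Definition crosses_properly_at x (e f : 'I_n * 'I_n) : Prop :=
  [/\ edge_interior e x, edge_interior f x &
      edge_segment e `&` edge_segment f = [set x]].

Definition heavy_crossing x : Prop :=
  exists E : {set 'I_n * 'I_n},
    [/\ E \subset edges n, (3 <= #|E|)%N &
        {in E &, forall e f, e != f -> crosses_properly_at x e f}].

Definition generic : Prop := forall x, ~ heavy_crossing x.

Definition drawing_set : set 'rV[R]_2 :=
  range p `|` \bigcup_(e in [set` edges n]) edge_segment e.

Definition is_face (F : set 'rV[R]_2) : Prop :=
  exists2 x, (~` drawing_set) x & F = connected_component (~` drawing_set) x.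

(* The size of a bounded face is the number of corners of the convex polygon
   of which it is the interior; c lists these corners. *)
Definition is_kface (k : nat) (F : set 'rV[R]_2) : Prop :=
  [/\ is_face F, bounded_set F &
      exists2 c : 'I_k -> 'rV[R]_2,
        convex_position c & F = interior (convex_hull (range c))].

End Drawing.

(* Main.v *)
Require Import Defs.
From mathcomp Require Import all_boot all_order all_algebra.
From mathcomp Require Import all_classical all_reals all_analysis.
From mathcomp Require Import ring lra zify.

(** Put the points on the parabola, at abscissas 1, 2, 4, ..., 2^N.  Writing a
    point of the plane as (a, a^2 + h), it lies below the line through points
    [i] and [j] exactly when h < (a - 2^i) (2^j - a).

    Doubling decides how chords cross.  If i1 < i2 < m and j1 < j2, then for a
    between 2^m and 2^j1 the product (a - 2^i1) (2^j1 - a) is smaller than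
    (a - 2^i2) (2^j2 - a), since replacing i1 by i2 costs a factor less than 2
    and replacing j1 by j2 gains a factor more than 2 ([doubling_lt]).  So two
    chords [i1, j1] and [i2, j2] that cross do so before 2^(i2 + 1).  Of three
    concurrent chords, sorted by left ends, the first two would cross to the
    right of the third left end; hence the drawing is generic.

    Let q be a point of a bounded face, off all the lines, with abscissa
    between 2^m and 2^(m+1).  The chords above q form a set of intervals [i, j]
    with i <= m < j that is closed under enlargement, a staircase.  Inside the
    polygon, caps cut off by nested intervals are nested, so only minimal chords
    above q and maximal chords below q can bound the face.  By [doubling_lt] the
    columns i < m of the staircase have at most two consecutive heights, which
    leaves at most five such chords, apart from one configuration with two more
    chords that the face does not reach ([pocket_excludes]).  This is
    [staircase_corners] and its geometric form [five_chords].

    It remains to pass from five lines to five corners.  The face is the open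
    cell of q in the arrangement of all lines, and a cell is already cut out by
    those lines that its boundary meets: leaving the cell along a segment from q
    means crossing such a line ([star_in_cell], [sides_sub_cell]).  Finally, a
    convex polygon cut out by s half-planes has at most s corners
    ([corners_le_sides]): a corner lies on at least two bounding lines, or it
    would be the midpoint of a segment in the polygon, and a line contains at
    most two corners, as of three the middle one is in the hull of the others. *)

Set Implicit Arguments.
Unset Strict Implicit.
Unset Printing Implicit Defensive.
Import Order.TTheory GRing.Theory Num.Theory.
Import numFieldNormedType.Exports.
Local Open Scope classical_set_scope.
Local Open Scope ring_scope.

(** * Corners of a staircase *)

Section Staircase.
Local Open Scope nat_scope.

(** Crossing the chord [i, j] from the side of q means crossing [e] too: among
    caps containing q the smaller one is met first, among caps avoiding q the
    larger one. *)
Definition hides (above : rel nat) i j (e : nat * nat) :=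
  if above e.1 e.2 then (i <= e.1) && (e.2 <= j) else (e.1 <= i) && (j <= e.2).

(** The situation in which the face is a wedge at point [m], between its chords
    to [K] and [K.+1], cut by the chords from [s] and [s.+1] to [J]. *)
Definition pocket (above : rel nat) m s J K :=
  [/\ s.+1 < m < J, J < K, above s J, ~~ above s.+1 J & above m K.+1 && ~~ above m K].

(** With [J] the height of column 0, columns up to [s] have height [J], columns
    strictly between [s] and [m] have height [J.+1] by the last hypothesis, and
    only column [m] is free, with height [K].  Reading off the corners gives at
    most five chords unless [s.+1 < m] and [J.+1 < K]; in that case the corners
    [(m.-1, J.+1)] and [(0, J.-1)] are left to the second alternative. *)
Lemma staircase_corners (above : rel nat) N m : m < N ->
    (forall i j, above i j -> i <= j -> i <= m < j) ->
    (forall i j i' j', above i j -> i' <= i -> i <= m < j -> j <= j' -> above i' j') ->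
    above 0 N ->
    (forall s J, above s J -> s < m.-1 -> m < J < N -> above m.-1 J.+1) ->
  exists S : seq (nat * nat), [/\ size S <= 5,
    all (fun e => e.1 <= e.2 <= N) S &
    forall i j, i <= j <= N ->
      has (hides above i j) S \/
      exists s J K, [/\ K < N, pocket above m s J K &
        (above m.-1 J.+1 && (i <= m.-1) && (J.+1 <= j)) ||
        (~~ above 0 J.-1 && (j <= J.-1))]].
Proof.
move=> mN straddle up a0N jump.
have exJ : exists j, above 0 j && (j <= N) by exists N; rewrite a0N leqnn.
case: (ex_minnP exJ) => J /andP[aJ JN] Jmin.
have mJ : m < J by have /andP[] := straddle _ _ aJ (leq0n _).
have J0 : above 0 J.-1 = false.
  apply/negbTE/negP => ab; move: (Jmin J.-1); rewrite ab /=.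
  by clear -mJ JN => H; have := H ltac:(lia); lia.
have exs : exists s, above s J && (s <= m) by exists 0; rewrite aJ.
case: (@ex_maxnP (fun s => above s J && (s <= m)) m exs _) => [s /andP[]//|].
move=> s /andP[as_ sm] smax.
have below_s i : s < i <= m -> above i J = false.
  move=> /andP[si im]; apply/negbTE/negP => ab.
  by have := smax i; rewrite ab im leqNgt si => /(_ isT).
have right : above m.+1 N = false.
  by apply/negbTE/negP => /straddle/(_ mN); rewrite ltnn.
have s1J : s < m -> above s.+1 J = false by move=> h; apply: below_s; rewrite leqnn h.
have jump_s : s < m.-1 -> J < N -> above m.-1 J.+1.
  by move=> h1 h2; apply: jump as_ h1 _; rewrite mJ h2.
case: (ltngtP s m) sm => // [sm _|es _]; last first.
  subst s; exists [:: (m, J); (0, J.-1); (m.+1, N)]; split=> //.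
    by rewrite /= leqnn; clear -mJ JN mN; lia.
  move=> i j ijN; left; rewrite /hides /= as_ J0 right.
  by clear -ijN mJ JN mN; lia.
have {}s1J := s1J sm.
have [/existsP[K0 /andP[mK0 aK0]]|/existsPn noK] :=
    boolP [exists j : 'I_N.+1, (m < j) && above m j]; last first.
  have mNF : above m N = false.
    by apply/negbTE; move: (noK ord_max); rewrite /= mN.
  have [/andP[sm1 JN1]|nj] := boolP ((s < m.-1) && (J < N)).
    exists [:: (s, J); (m.-1, J.+1); (0, J.-1); (s.+1, J); (m, N)]; split=> //.
      by rewrite /=; clear -mJ JN mN sm sm1 JN1; lia.
    move=> i j ijN; left; rewrite /hides /= as_ J0 s1J mNF jump_s//.
    by clear -ijN mJ JN mN sm sm1 JN1; lia.
  exists [:: (s, J); (0, J.-1); (s.+1, J); (m, N)]; split=> //.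
    by rewrite /=; clear -mJ JN mN sm; lia.
  move=> i j ijN; left; rewrite /hides /= as_ J0 s1J mNF.
  by clear -ijN mJ JN mN sm nj; lia.
have exK : exists K, [&& m < K, above m K & K <= N].
  by exists K0; rewrite mK0 aK0 -ltnS ltn_ord.
case: (ex_minnP exK) => K /and3P[mK aK KN] Kmin.
have JK : J < K.
  rewrite ltnNge; apply/negP => KJ.
  suff : above m J by rewrite below_s// sm leqnn.
  by apply: up aK _ _ KJ => //; rewrite leqnn.
have bK : above m K.-1 = false.
  apply/negbTE/negP => ab; move: (Kmin K.-1); rewrite ab.
  by clear -KN mJ JK => H; have := H ltac:(lia); lia.
case: (ltnP s.+1 m) => [sm1|ms1]; last first.
  exists [:: (s, J); (m, K); (0, J.-1); (m, K.-1); (m.+1, N)]; split=> //.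
    by rewrite /=; clear -mJ JN mN sm ms1 mK KN; lia.
  move=> i j ijN; left; rewrite /hides /= as_ aK J0 bK right.
  by clear -ijN mJ JN mN sm ms1 mK KN JK; lia.
have sm2 : s < m.-1 by clear -sm1; lia.
have JN1 : J < N by clear -JK KN; lia.
have {jump_s}aj := jump_s sm2 JN1.
case: (ltngtP J.+1 K) JK => // [JK1 _|eK _]; last first.
  subst K; exists [:: (s, J); (m, J.+1); (0, J.-1); (s.+1, J); (m.+1, N)]; split=> //.
    by rewrite /=; clear -mJ JN1 mN sm sm1; lia.
  move=> i j ijN; left; rewrite /hides /= as_ aK J0 s1J right.
  by clear -ijN mJ JN1 mN sm sm1; lia.
exists [:: (s, J); (m, K); (s.+1, J); (m, K.-1); (m.+1, N)]; split=> //.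
  by rewrite /=; clear -mJ JN1 mN sm sm1 mK KN; lia.
move=> i j ijN.
have [out|] := boolP ((s < i < m) && (J < j) || (i < m) && (j < J)).
  right; exists s, J, K.-1; split; first by clear -mK KN; lia.
    rewrite /pocket as_ s1J prednK ?aK ?bK; last by clear -mK; lia.
    by split=> //; clear -sm1 mJ JK1; lia.
  by rewrite aj J0; clear -out mJ sm1; lia.
move=> inn; left; rewrite /hides /= as_ aK s1J bK right.
by clear -ijN inn mJ JN1 mN sm sm1 mK KN JK1; lia.
Qed.

End Staircase.

(** * Chords of the parabola over abscissas that double *)

Section Doubling.
Variable R : realFieldType.
Implicit Types (a b h k : R) (i j l m N J K s : nat).

Definition pow2 (i : nat) : R := 2 ^+ i.

Lemma pow2_gt0 i : 0 < pow2 i. Proof. exact: exprn_gt0. Qed.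

Lemma pow2_double i j : (i < j)%N -> 2 * pow2 i <= pow2 j.
Proof. by move=> ij; rewrite /pow2 -exprS ler_weXn2l ?ler1n. Qed.

Lemma pow2_lt i j : (pow2 i < pow2 j) = (i < j)%N.
Proof. by rewrite /pow2 ltr_eXn2l ?ltr1n. Qed.

Lemma pow2_le i j : (pow2 i <= pow2 j) = (i <= j)%N.
Proof. by rewrite /pow2 ler_eXn2l ?ltr1n. Qed.

(** The left factor drops by less than half since [b] is at least twice
    [pow2 i2], and the right factor more than doubles since [0 < b]. *)
Lemma doubling_lt i1 i2 m j1 j2 b :
  (i1 < i2 < m)%N -> (j1 < j2)%N -> pow2 m <= b -> b < pow2 j1 ->
  (b - pow2 i1) * (pow2 j1 - b) < (b - pow2 i2) * (pow2 j2 - b).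
Proof.
move=> /andP[i12 i2m] j12 mb bj.
have := pow2_double i2m; have := pow2_double j12; have := pow2_gt0 i1.
have := pow2_gt0 i2; set A := pow2 i1; set B := pow2 i2; set C := pow2 j1.
set D := pow2 j2 => B0 A0 CD Bm.
have b2 : 2 * B <= b by apply: le_trans mb.
rewrite -/C in bj.
have h1 : (b - A) * (C - b) < b * (C - b) by rewrite ltr_pM2r; lra.
have h2 : b * (C - b) <= (2 * (b - B)) * (C - b) by rewrite ler_pM2r; lra.
have h3 : (b - B) * (2 * (C - b)) <= (b - B) * (D - b).
  by rewrite ler_wpM2l; lra.
lra.
Qed.

(** The vertical distance from the line through the parabola points over [2^i]
    and [2^j] up to the point [(a, a^2 + h)]. *)
Definition gap i j a h : R := h + (a - pow2 i) * (a - pow2 j).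

Lemma gapC i j a h : gap i j a h = gap j i a h.
Proof. by rewrite /gap mulrC. Qed.

Lemma on_chord i j b k : (i <= j)%N -> 0 <= k -> gap i j b k = 0 ->
  pow2 i <= b <= pow2 j.
Proof.
rewrite -pow2_le /gap => ij k0 e; apply/andP; split; rewrite leNgt; apply/negP => lt.
  have : 0 < (b - pow2 i) * (b - pow2 j) by rewrite nmulr_rgt0; lra.
  lra.
have : 0 < (b - pow2 i) * (b - pow2 j) by rewrite pmulr_rgt0; lra.
lra.
Qed.

(** The inner cap of the parabola lies within the outer one, so a point of the
    inner cap on the outer chord has to be on the inner chord too. *)
Lemma nested_above i j i' j' b k : (i <= i')%N -> (i' <= j')%N -> (j' <= j)%N -> 0 <= k ->
  gap i' j' b k <= 0 -> gap i j b k = 0 -> gap i' j' b k = 0.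
Proof.
move=> ii ij jj k0 neg e.
have bij : pow2 i' <= b <= pow2 j'.
  move: ij neg; rewrite -pow2_le /gap => ij neg.
  apply/andP; split; rewrite leNgt; apply/negP => lt.
    have : 0 < (b - pow2 i') * (b - pow2 j') by rewrite nmulr_rgt0; lra.
    lra.
  have : 0 < (b - pow2 i') * (b - pow2 j') by rewrite pmulr_rgt0; lra.
  lra.
move: ii jj bij neg e; rewrite -!pow2_le /gap => ii jj /andP[b1 b2] neg e.
have : (b - pow2 i') * (pow2 j' - b) <= (b - pow2 i) * (pow2 j - b).
  by rewrite ler_pM //; lra.
lra.
Qed.

Lemma nested_below i j i' j' b k : (i' <= i)%N -> (i <= j)%N -> (j <= j')%N -> 0 <= k ->
  0 <= gap i' j' b k -> gap i j b k = 0 -> gap i' j' b k = 0.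
Proof.
move=> ii ij jj k0 pos e.
have /andP[b1 b2] := on_chord ij k0 e.
move: ii jj pos e; rewrite -!pow2_le /gap => ii jj pos e.
have : (b - pow2 i) * (pow2 j - b) <= (b - pow2 i') * (pow2 j' - b).
  by rewrite ler_pM //; lra.
lra.
Qed.

(** The wedge at point [m] lies to the right of [2^m].  There the chord from [s]
    to [J] stays below the chord from [m.-1] to [J.+1], and the chord from 0 to
    [J.-1] stays below the chord from [s.+1] to [J], so that neither outer chord
    meets the pocket. *)
Lemma pocket_excludes m s J K b k :
    (s.+1 < m < J)%N -> (J < K)%N -> 0 <= k ->
    0 <= gap m K b k -> gap m K.+1 b k <= 0 ->
    gap s J b k <= 0 -> 0 <= gap s.+1 J b k ->
  gap m.-1 J.+1 b k <> 0 /\ gap 0 J.-1 b k <> 0.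
Proof.
move=> /andP[s1m mJ] JK k0 mK mK1 sJ s1J.
have mb : pow2 m <= b.
  have := ltnSn K; rewrite -pow2_lt => KK.
  have : 0 <= (b - pow2 m) * (pow2 K.+1 - pow2 K) by move: mK mK1; rewrite /gap; lra.
  by rewrite pmulr_lge0; lra.
split=> e.
  have [bJ|Jb] := ltP b (pow2 J).
    have smm : (s < m.-1 < m)%N by lia.
    have := doubling_lt smm (ltnSn J) mb bJ; move: e sJ; rewrite /gap; lra.
  have [m1m sm JJ] : [/\ pow2 m.-1 < pow2 m, pow2 s < pow2 m & pow2 J < pow2 J.+1].
    by rewrite !pow2_lt; split; lia.
  move: sJ e; rewrite /gap => sJ e.
  have p : 0 <= (b - pow2 s) * (b - pow2 J) by rewrite mulr_ge0; lra.
  have /eqP : (b - pow2 s) * (b - pow2 J) = 0 by lra.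
  rewrite mulf_eq0 => /orP[/eqP|/eqP bz]; first lra.
  have kz : k = 0 by lra.
  have : (b - pow2 m.-1) * (b - pow2 J.+1) < 0 by rewrite pmulr_rlt0; lra.
  lra.
have /andP[_ ] := on_chord (leq0n _) k0 e.
have JJ : (J.-1 < J)%N by lia.
rewrite le_eqVlt => /orP[/eqP bJ|bJ].
  have [s1 J1] : pow2 s.+1 < pow2 m /\ pow2 J.-1 < pow2 J by rewrite !pow2_lt.
  have : (b - pow2 s.+1) * (b - pow2 J) < 0 by rewrite pmulr_rlt0; lra.
  by move: e s1J; rewrite /gap bJ subrr mulr0; lra.
have smm : (0 < s.+1 < m)%N by lia.
by have := doubling_lt smm JJ mb bJ; move: e s1J; rewrite /gap; lra.
Qed.

Definition same_side N a h b k := forall i j, (i <= N)%N -> (j <= N)%N ->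
  0 <= gap i j a h * gap i j b k.

(** For points [(b, b^2 + k)] of the closed cell of [(a, a^2 + h)]: whichever
    line such a point lies on, it lies on a line of [S], so [S] bounds the cell. *)
Lemma five_chords N m a h : (m < N)%N -> pow2 m < a < pow2 m.+1 -> 0 < h ->
    (forall i j, (i <= N)%N -> (j <= N)%N -> gap i j a h != 0) ->
    gap 0 N a h < 0 ->
  exists S : seq (nat * nat), [/\ (size S <= 5)%N,
    forall e, e \in S -> (e.1 <= N)%N && (e.2 <= N)%N &
    forall b k, 0 <= k -> same_side N a h b k ->
      forall i j, (i <= N)%N -> (j <= N)%N -> gap i j b k = 0 ->
      exists2 e, e \in S & gap e.1 e.2 b k = 0].
Proof.
move=> mN /andP[ma am] h0 ne0 h0N.
pose above : rel nat := fun i j => gap i j a h < 0.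
have straddle i j : above i j -> (i <= j)%N -> (i <= m < j)%N.
  rewrite /above => ab ij; apply/andP; split; rewrite leqNgt; apply/negP => lt.
    have mj := leq_trans lt ij; move: lt mj ab; rewrite -!pow2_le /gap => lt mj ab.
    have : 0 <= (a - pow2 i) * (a - pow2 j) by rewrite mulr_le0; lra.
    lra.
  have im := leq_trans ij lt; move: lt im ab; rewrite !ltnS -!pow2_le /gap => lt im ab.
  have : 0 <= (a - pow2 i) * (a - pow2 j) by rewrite mulr_ge0; lra.
  lra.
have up i j i' j' : above i j -> (i' <= i)%N -> (i <= m < j)%N -> (j <= j')%N -> above i' j'.
  rewrite /above /gap => ab ii /andP[im mj] jj.
  move: ii im mj jj; rewrite -!pow2_le => ii im mj jj.
  have : (a - pow2 i) * (pow2 j - a) <= (a - pow2 i') * (pow2 j' - a).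
    by rewrite ler_pM //; lra.
  lra.
have jump s J : above s J -> (s < m.-1)%N -> (m < J < N)%N -> above m.-1 J.+1.
  move=> sJ sm /andP[mJ _]; have smm : (s < m.-1 < m)%N by lia.
  have aJ : a < pow2 J by apply: lt_le_trans am _; rewrite pow2_le.
  have := doubling_lt smm (ltnSn J) (ltW ma) aJ; move: sJ; rewrite /above /gap; lra.
have [S [S5 SN cover]] := staircase_corners mN straddle up h0N jump.
exists S; split=> // [e /(allP SN) /=|]; first by clear; lia.
move=> b k k0 side.
have sideA i j : (i <= N)%N -> (j <= N)%N -> above i j -> gap i j b k <= 0.
  by move=> iN jN ab; have := side i j iN jN; rewrite nmulr_rge0.
have sideB i j : (i <= N)%N -> (j <= N)%N -> ~~ above i j -> 0 <= gap i j b k.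
  move=> iN jN; rewrite /above -leNgt le_eqVlt eq_sym (negbTE (ne0 _ _ iN jN)) /= => p.
  by have := side i j iN jN; rewrite pmulr_rge0.
suff ordered i j : (i <= j <= N)%N -> gap i j b k = 0 ->
    exists2 e, e \in S & gap e.1 e.2 b k = 0.
  move=> i j iN jN; have [ij|/ltnW ji] := leqP i j; first by apply: ordered; rewrite ij.
  by rewrite gapC; apply: ordered; rewrite ji.
move=> ijN z; have /andP[ij jN] := ijN.
have [/hasP[[i' j'] eS]|[s [J [K [KN [smJ JK sJ s1J mK] out]]]]] := cover i j ijN.
  have /andP[/= ij' jN'] := allP SN _ eS; have iN' := leq_trans ij' jN'.
  rewrite /hides /=; case: ifPn => ab /andP[ii jj]; exists (i', j') => //=.
    by apply: nested_above ii ij' jj k0 _ z; exact: sideA.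
  by apply: nested_below ii ij jj k0 _ z; exact: sideB.
have [mK1 mK0] := andP mK.
have [no1 no2] : gap m.-1 J.+1 b k <> 0 /\ gap 0 J.-1 b k <> 0.
  have [mN' sN s1N JN] : [/\ m <= N, s <= N, s.+1 <= N & J <= N]%N.
    by split; clear -smJ JK KN mN; lia.
  apply: (@pocket_excludes m s J K) => //.
  - exact: sideB (ltnW KN) mK0.
  - exact: sideA.
  - exact: sideA.
  - exact: sideB.
case/orP: out => [/andP[/andP[ab im] Jj]|/andP[ab jJ]].
  case: no1; apply: nested_above im _ Jj k0 _ z; first by clear -smJ; lia.
  by apply: sideA => //; clear -smJ JK KN mN; lia.
case: no2; apply: nested_below (leq0n i) ij jJ k0 _ z.
by apply: sideB => //; clear -smJ JK KN mN; lia.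
Qed.

(** Inside the convex polygon a point is above some edge [(i, i.+1)] over its
    own abscissa, hence above the parabola.  Points beyond the two ends cannot be
    both above the outer bottom edge and below the top edge. *)
Lemma above_parabola N b k : (1 < N)%N ->
    (forall i, (i < N)%N -> 0 <= gap i i.+1 b k) -> gap 0 N b k <= 0 -> 0 <= k.
Proof.
move=> N1 low top.
have x1N : pow2 1 < pow2 N by rewrite pow2_lt.
have x0N : pow2 0 < pow2 N.-1 by rewrite pow2_lt; lia.
have b0 : pow2 0 <= b.
  rewrite leNgt; apply/negP => lt; have := low 0 (ltnW N1); move: top; rewrite /gap => top l0.
  have : 0 < (b - pow2 0) * (pow2 1 - pow2 N) by rewrite nmulr_lgt0; lra.
  lra.
have bN : b <= pow2 N.
  rewrite leNgt; apply/negP => lt.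
  have N1' : (N.-1 < N)%N by lia.
  have := low _ N1'; rewrite prednK; last lia.
  move: top; rewrite /gap => top l0.
  have : 0 < (b - pow2 N) * (pow2 N.-1 - pow2 0) by rewrite pmulr_lgt0; lra.
  lra.
have exi : exists i, (pow2 i <= b) && (i < N)%N by exists 0; rewrite b0 ltnW.
case: (@ex_maxnP _ N exi _) => [i /andP[_ /ltnW]//|i /andP[ib iN] imax].
have bi : b <= pow2 i.+1.
  have [iN1|] := ltnP i.+1 N; last first.
    by move=> Ni; rewrite (_ : i.+1 = N)//; clear -Ni iN; lia.
  by rewrite leNgt; apply/negP => /ltW lt; have := imax i.+1; rewrite lt iN1 ltnn => /(_ isT).
have := low _ iN; rewrite /gap.
have : 0 <= (b - pow2 i) * (pow2 i.+1 - b) by rewrite mulr_ge0; lra.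
lra.
Qed.

Lemma strip N a : pow2 0 < a < pow2 N -> (forall i, (i <= N)%N -> a != pow2 i) ->
  exists2 m, (m < N)%N & pow2 m < a < pow2 m.+1.
Proof.
move=> /andP[a0 aN] ne.
have exi : exists i, (pow2 i < a) && (i <= N)%N by exists 0; rewrite a0.
case: (@ex_maxnP _ N exi _) => [i /andP[]//|m /andP[ma mN] mmax].
have lt : (m < N)%N.
  by rewrite ltn_neqAle mN andbT; apply: contraTneq ma => ->; rewrite -leNgt ltW.
exists m => //; rewrite ma /= ltNge le_eqVlt; apply/negP => /orP[/eqP e|l].
  by have := ne _ lt; rewrite e eqxx.
by have := mmax m.+1; rewrite l lt ltnn => /(_ isT).
Qed.

End Doubling.

(** * Corners and sides of a convex polygon *)

Section Convexity.
Variable R : realType.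
Local Notation V := ('rV[R]_2).
Implicit Types (x y z q d : V) (t : R) (A : set V).

Lemma convex_setE A : convex_set A <->
  forall x y t, A x -> A y -> 0 <= t <= 1 -> A ((1 - t) *: x + t *: y).
Proof.
split=> [cA x y t Ax Ay /andP[t0 t1]|cA x y l /set_mem Ax /set_mem Ay].
  pose l : {i01 R} := Itv01 t0 t1.
  have := cA y x l; rewrite !inE => /(_ Ay Ax).
  by congr A; rewrite addrC.
apply/mem_set; have := cA y x l%:num Ay Ax; rewrite addrC.
by apply; rewrite ge0 le1.
Qed.

Lemma convex_hull_convex A : convex_set (convex_hull A).
Proof.
apply/convex_setE => x y t hx hy t01 B [cB AB].
by move/convex_setE: (cB); apply=> //; [apply: hx|apply: hy].
Qed.

Lemma convex_combination A (I : finType) (P : pred I) (w : I -> R) (c : I -> V) :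
    convex_set A -> (forall i, P i -> A (c i)) -> (forall i, 0 <= w i) ->
    0 < \sum_(i | P i) w i ->
  exists2 z, A z & \sum_(i | P i) w i *: c i = (\sum_(i | P i) w i) *: z.
Proof.
move=> /convex_setE cA Ac w0.
have [i0 Pi0 _|P0] := pickP P; last by rewrite big_pred0 ?ltxx.
pose K (u : V) (W : R) := 0 <= W /\ exists2 z, A z & u = W *: z.
suff [] : K (\sum_(i | P i) w i *: c i) (\sum_(i | P i) w i) by [].
apply: (big_rec2 K) => [|i u W Pi [W0 [z Az ->]]].
  by split=> //; exists (c i0); [exact: Ac|exact/esym/scale0r].
split; first exact: addr_ge0.
have [T0|T0] := eqVneq (w i + W) 0.
  exists z => //; have [-> ->] : w i = 0 /\ W = 0 by have := w0 i; lra.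
  by rewrite !addr0 !scale0r addr0.
have Tp : 0 < w i + W by rewrite lt0r T0 addr_ge0.
exists ((1 - W / (w i + W)) *: c i + (W / (w i + W)) *: z).
  apply: cA => //; first exact: Ac.
  by rewrite divr_ge0 ?addr_ge0//= ler_pdivrMr// mul1r; have := w0 i; lra.
rewrite scalerDr !scalerA; congr (_ *: _ + _ *: _); field; exact: T0.
Qed.

Definition simplex k : set 'rV[R]_k :=
  [set w | (forall j, 0 <= w 0 j) /\ \sum_j w 0 j = 1].

Definition weighted_sum k (c : 'I_k -> V) (w : 'rV[R]_k) : V :=
  \sum_j w 0 j *: c j.

Lemma simplex_compact k : compact (@simplex k).
Proof.
have cube := @rV_compact _ k _ (fun=> @segment_compact R 0 1).
rewrite (_ : @simplex k = [set v : 'rV[R]_k | forall i, `[0, 1]%classic (v ord0 i)]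
    `&` ((fun w : 'rV[R]_k => \sum_j w 0 j) @^-1` [set 1])).
  apply: compact_closedI => //; apply: preimage_closed; last exact: closed_eq.
  move=> w _; apply: continuous_big => [|i _]; first exact: add_continuous.
  exact: coord_continuous.
apply/seteqP; split=> [w [w0 w1]|w [wI w1]]; split=> //= i.
  rewrite in_itv /= w0 -w1 (bigD1 i)//= lerDl sumr_ge0//.
by have := wI i; rewrite /= in_itv /= => /andP[].
Qed.

Lemma simplex_image_closed k (c : 'I_k -> V) : closed (weighted_sum c @` @simplex k).
Proof.
apply: compact_closed; first exact: norm_hausdorff.
apply: continuous_compact; last exact: simplex_compact.
apply: continuous_subspaceT.
apply: continuous_big => [|i _ w]; first exact: add_continuous.
by apply: cvgZr_tmp; [exact: nbhs_filter w|exact: coord_continuous].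
Qed.

Lemma sub_simplex_image k (c : 'I_k -> V) :
  convex_hull (range c) `<=` weighted_sum c @` @simplex k.
Proof.
apply: smallest_sub.
  apply/convex_setE => _ _ t [w [w0 w1] <-] [v [v0 v1] <-] /andP[t0 t1].
  exists ((1 - t) *: w + t *: v).
    split=> [j|]; first by rewrite !mxE addr_ge0 // mulr_ge0 // subr_ge0.
    under eq_bigr do rewrite !mxE.
    by rewrite big_split /= -!mulr_sumr w1 v1 !mulr1 subrK.
  rewrite /weighted_sum !scaler_sumr -big_split /=; apply: eq_bigr => j _.
  by rewrite !mxE [LHS]scalerDl !scalerA.
move=> _ [i _ <-]; exists (delta_mx 0 i).
  split=> [j|]; first by rewrite mxE ler0n.
  rewrite (bigD1 i)//= big1 ?addr0 ?mxE ?eqxx// => j /negbTE ji.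
  by rewrite mxE ji.
rewrite /weighted_sum (bigD1 i)//= big1 ?addr0 ?mxE ?eqxx ?scale1r// => j /negbTE ji.
by rewrite mxE ji scale0r.
Qed.

(** Averaging the weights of the two points writes [c i] as a convex combination
    of all corners; unless all weight is on [c i], dividing by the weight off
    [c i] puts [c i] in the hull of the other corners. *)
Lemma corner_extreme k (c : 'I_k -> V) i (u : V) : convex_position c ->
    (weighted_sum c @` @simplex k) (c i + u) -> (weighted_sum c @` @simplex k) (c i - u) ->
  u = 0.
Proof.
move=> cP [w [w0 w1] wE] [v [v0 v1] vE].
have two : \sum_j (w 0 j + v 0 j) *: c j = (1 + 1) *: c i.
  under eq_bigr do rewrite scalerDl.
  rewrite big_split /= -/(weighted_sum c w) -/(weighted_sum c v) wE vE scalerDl scale1r.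
  by rewrite addrACA subrr addr0.
have sum2 : \sum_j (w 0 j + v 0 j) = 1 + 1 by rewrite big_split /= w1 v1.
have wv0 j : 0 <= w 0 j + v 0 j by rewrite addr_ge0.
have : 0 <= \sum_(j < k | j != i) (w 0 j + v 0 j) by exact: sumr_ge0.
rewrite le_eqVlt => /predU1P[/esym/eqP|W0].
  rewrite psumr_eq0// => /allP z.
  have w_z j : j != i -> w 0 j = 0.
    move=> ji; have := z j (mem_index_enum _); rewrite ji /= => /eqP.
    by have := w0 j; have := v0 j; lra.
  have wi1 : w 0 i = 1 by rewrite -w1 (bigD1 i)//= big1 ?addr0.
  have : c i = c i + u.
    rewrite -wE /weighted_sum (bigD1 i)//= wi1 scale1r big1 ?addr0// => j /w_z ->.
    exact: scale0r.
  by move=> cu; apply: (addrI (c i)); rewrite addr0.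
have [z hz] := convex_combination (@convex_hull_convex (c @` [set j | j != i]))
   (fun j (ji : j != i) => sub_gen_smallest (ex_intro2 _ _ j ji erefl)) wv0 W0.
move: two sum2; rewrite (bigD1 i)//= (bigD1 i (F := fun j => _ + _))//=.
set W := \sum_(j < k | _) _ in W0 *; set ws := w 0 i + v 0 i.
move=> two sum2 zE; case: (cP i); suff <- : z = c i by [].
apply: (scalerI (lt0r_neq0 W0)); rewrite -zE.
have -> : W = (1 + 1) - ws by rewrite -sum2; ring.
by rewrite [RHS]scalerBl -two; apply/eqP; rewrite eq_sym subr_eq addrC.
Qed.

End Convexity.

Section HalfPlanes.
Variable R : realType.
Local Notation V := ('rV[R]_2).
Implicit Types (x y z q d : V) (t : R) (A : set V).

(** A triple [l] stands for the affine function [aff l] with linear part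
    [lin l]; triples have decidable equality, so that finite families of
    half-planes are sequences. *)
Definition lin (l : R * R * R) (d : V) := l.1.1 * d 0 0 + l.1.2 * d 0 1.
Definition aff (l : R * R * R) (z : V) := lin l z + l.2.

Lemma aff_conv l x y t : aff l ((1 - t) *: x + t *: y) = (1 - t) * aff l x + t * aff l y.
Proof. by rewrite /aff /lin !mxE; ring. Qed.

Lemma aff_move l x d t : aff l (x + t *: d) = aff l x + t * lin l d.
Proof. by rewrite /aff /lin !mxE; ring. Qed.

Lemma plane_eq x y : x 0 0 = y 0 0 -> x 0 1 = y 0 1 -> x = y.
Proof.
move=> e0 e1; apply/rowP => -[[|[|//]] lt].
  by rewrite (_ : Ordinal lt = 0) //; exact/val_inj.
by rewrite (_ : Ordinal lt = 1) //; exact/val_inj.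
Qed.

(** A neighbourhood of [z] in [A], shrunk towards [x], is a neighbourhood of the
    new point that stays in [A]. *)
Lemma interior_convex_step A x z t : convex_set A -> A x -> interior A z -> 0 < t <= 1 ->
  interior A ((1 - t) *: x + t *: z).
Proof.
move=> cA Ax Az /andP[t0 t1].
have tn0 : t != 0 by rewrite gt_eqF.
pose g (w : V) := t^-1 *: (w - (1 - t) *: x).
have oU : open (g @^-1` interior A).
  apply: open_comp; last exact: open_interior.
  move=> w _; have wx : (w - (1 - t) *: x) @[w --> w] --> w - (1 - t) *: x.
    apply: cvgB; [exact: (nbhs_filter w)|exact: cvg_id|].
    by apply: cvg_cst; exact: (nbhs_filter w).
  by apply: cvgZl_tmp wx; exact: (nbhs_filter w).
have UA : g @^-1` interior A `<=` A.
  move=> w /interior_subset gw.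
  have -> : w = (1 - t) *: x + t *: g w.
    by rewrite /g scalerA divff// scale1r addrC subrK.
  by move/convex_setE: cA; apply; rewrite // (ltW t0).
move: UA; rewrite (open_subsetE _ oU); apply.
by rewrite /preimage /= /g addrC addKr scalerA mulVf// scale1r.
Qed.

(** Constraints that are not tight at [x] leave room for a small step along [d],
    and tight ones do not change along [d]. *)
Lemma slack (S : seq (R * R * R)) x d :
    (forall l, l \in S -> 0 <= aff l x) ->
    (forall l, l \in S -> aff l x = 0 -> lin l d = 0) ->
  exists2 e, 0 < e & forall l, l \in S -> e * `|lin l d| <= aff l x.
Proof.
elim: S => [|l S IH] pos tight; first by exists 1.
have [||e e0 eS] := IH; [by move=> l' l'S; apply: pos; rewrite inE l'S orbT| |].
  by move=> l' l'S; apply: tight; rewrite inE l'S orbT.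
have [e' e'0 el] : exists2 e', 0 < e' & e' * `|lin l d| <= aff l x.
  have := pos l (mem_head _ _); rewrite le_eqVlt => /predU1P[/esym z|p].
    by exists 1 => //; rewrite z tight ?mem_head ?normr0 ?mulr0.
  exists (aff l x / (1 + `|lin l d|)).
    by rewrite divr_gt0// ltr_pwDl.
  rewrite -mulrA ger_pMr// ler_pdivrMl ?ltr_pwDl// mulr1.
  by rewrite lerDr.
exists (Num.min e e'); first by rewrite lt_min e0.
move=> l'; rewrite inE => /predU1P[->|l'S].
  by apply: le_trans el; rewrite ler_wpM2r// ge_min lexx orbT.
by apply: le_trans (eS _ l'S); rewrite ler_wpM2r// ge_min lexx.
Qed.

Lemma closed_limit (D : set V) y q : closed D ->
  (forall t, 0 < t <= 1 -> D ((1 - t) *: y + t *: q)) -> D y.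
Proof.
move=> cD Dt.
apply: (@closed_cvg _ _ (0 : R)^'+ _ (fun t : R => (1 - t) *: y + t *: q) D cD).
  near=> t; apply: Dt; apply/andP; split; near: t; first exact: nbhs_right_gt.
  exact: nbhs_right_le.
have -> : (fun t : R => (1 - t) *: y + t *: q) = (fun t => y + t *: (q - y)).
  by apply/funext => t; apply: plane_eq; rewrite !mxE; ring.
rewrite -[X in _ --> X]addr0 -(scale0r (q - y)).
apply: cvgD; first exact: cvg_cst.
by apply: cvgZr_tmp; apply: cvg_at_right_filter; exact: cvg_id.
Unshelve. all: by end_near. Qed.

End HalfPlanes.

Section PolygonCorners.
Variable R : realType.
Local Notation V := ('rV[R]_2).
Implicit Types (x y z q d : V) (t : R) (A : set V).

(** [s] is the coordinate along the line, and together with [lin l] it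
    determines a point. *)
Lemma between x y z (l : R * R * R) : (l.1.1 != 0) || (l.1.2 != 0) ->
    aff l x = 0 -> aff l y = 0 -> aff l z = 0 ->
    let s u := l.1.1 * u 0 1 - l.1.2 * u 0 0 in s x <= s y <= s z ->
  exists2 t, 0 <= t <= 1 & y = (1 - t) *: x + t *: z.
Proof.
move=> l0 ax ay az s /andP[xy yz].
have norm0 : l.1.1 ^+ 2 + l.1.2 ^+ 2 != 0.
  by rewrite paddr_eq0 ?sqr_ge0// !sqrf_eq0 negb_and.
have rot u v : lin l u = lin l v -> s u = s v -> u = v.
  rewrite /lin /s => e1 e2; apply: plane_eq; apply: (mulfI norm0).
    have -> : forall w : V, (l.1.1 ^+ 2 + l.1.2 ^+ 2) * w 0 0 =
      l.1.1 * (l.1.1 * w 0 0 + l.1.2 * w 0 1) - l.1.2 * (l.1.1 * w 0 1 - l.1.2 * w 0 0).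
      by move=> w; ring.
    by rewrite e1 e2; ring.
  have E (w : V) : (l.1.1 ^+ 2 + l.1.2 ^+ 2) * w 0 1 =
    l.1.2 * (l.1.1 * w 0 0 + l.1.2 * w 0 1) + l.1.1 * (l.1.1 * w 0 1 - l.1.2 * w 0 0).
    by ring.
  by rewrite !E e1 e2.
have affE u : lin l u = aff l u - l.2 by rewrite /aff; ring.
have [e|ne] := eqVneq (s x) (s z).
  exists 0; first by rewrite lexx ler01.
  rewrite subr0 scale1r scale0r addr0; apply: rot; first by rewrite !affE ay ax.
  by move: xy yz; rewrite e => xy yz; apply/eqP; rewrite eq_le xy yz.
have lt : s x < s z by rewrite lt_neqAle ne (le_trans xy yz).
have nz : s z - s x != 0 by rewrite subr_eq0 eq_sym.
exists ((s y - s x) / (s z - s x)).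
  by rewrite divr_ge0 ?subr_ge0 ?(ltW lt)//= ler_pdivrMr ?subr_gt0// mul1r lerB.
apply: rot; first by rewrite !affE aff_conv ay ax az; ring.
have sE t : s ((1 - t) *: x + t *: z) = (1 - t) * s x + t * s z.
  by rewrite /s !mxE; ring.
by rewrite sE; field.
Qed.

Lemma corners_on_line k (c : 'I_k -> V) (l : R * R * R) : convex_position c ->
  (l.1.1 != 0) || (l.1.2 != 0) -> (#|[pred i | aff l (c i) == 0%R]| <= 2)%N.
Proof.
move=> cP l0; rewrite leqNgt; apply/negP => /card_gt2P[i [j [m]]].
pose s (u : V) := l.1.1 * u 0 1 - l.1.2 * u 0 0.
rewrite !inE => -[[/eqP zi /eqP zj /eqP zm] [ij jm mi]].
have no (a b d : 'I_k) : a != b -> d != b -> aff l (c a) = 0 -> aff l (c b) = 0 ->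
    aff l (c d) = 0 -> s (c a) <= s (c b) <= s (c d) -> False.
  move=> ab db za zb zd sle; have [t t01 bE] := between l0 za zb zd sle.
  apply: (cP b); rewrite bE; move/convex_setE: (@convex_hull_convex _ (c @` [set j | j != b])).
  by apply=> //; apply: sub_gen_smallest; [exists a|exists d].
have [ji im mj] : [/\ j != i, i != m & m != j] by rewrite eq_sym ij eq_sym mi eq_sym jm.
have [|/ltW] := lerP (s (c i)) (s (c j)); have [|/ltW] := lerP (s (c j)) (s (c m));
have [|/ltW] := lerP (s (c i)) (s (c m)) => h1 h2 h3.
- by apply: (no i j m) => //; rewrite h3 h2.
- by apply: (no i j m) => //; rewrite h3 h2.
- by apply: (no i m j) => //; rewrite h1 h2.
- by apply: (no m i j) => //; rewrite h1 h3.
- by apply: (no j i m) => //; rewrite h1 h3.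
- by apply: (no j m i) => //; rewrite h1 h2.
- by apply: (no m j i) => //; rewrite h2 h3.
- by apply: (no m j i) => //; rewrite h2 h3.
Qed.

Section Polygon.
Variables (k : nat) (c : 'I_k -> V) (S : seq (R * R * R)) (q : V).
Hypothesis cP : convex_position c.
Hypothesis FE : [set z | forall l, l \in S -> 0 < aff l z] = interior (convex_hull (range c)).
Hypothesis S0 : forall l, l \in S -> (l.1.1 != 0) || (l.1.2 != 0).
Hypothesis Sq : forall l, l \in S -> 0 < aff l q.

(** Were at most one side tight at [c i], one could move from [c i] in both
    directions along that side, or in any direction if there is none, without
    leaving the polygon; but a corner is not a midpoint. *)
Lemma two_sides_at_corner i : (2 <= count (fun l => aff l (c i) == 0%R) (undup S))%N.
Proof.
have Fq : interior (convex_hull (range c)) q by rewrite -FE.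
have ci_ge0 l : l \in S -> 0 <= aff l (c i).
  move=> lS; rewrite leNgt; apply/negP => neg.
  have ap := Sq lS.
  pose t := - aff l (c i) / (aff l q - aff l (c i)).
  have d0 : 0 < aff l q - aff l (c i) by lra.
  have t0 : 0 < t by rewrite divr_gt0 // oppr_gt0.
  have t1 : t <= 1 by rewrite ler_pdivrMr// mul1r; lra.
  have : interior (convex_hull (range c)) ((1 - t) *: c i + t *: q).
    apply: interior_convex_step => //; [exact: convex_hull_convex| |by rewrite t0].
    by apply: sub_gen_smallest; exists i.
  rewrite -FE => /(_ l lS); rewrite aff_conv.
  suff -> : (1 - t) * aff l (c i) + t * aff l q = 0 by rewrite ltxx.
  by rewrite /t; field; rewrite gt_eqF.
rewrite ltnNge; apply/negP => one.
have [d d0 dS] : exists2 d : V, d != 0 & forall l, l \in S -> aff l (c i) = 0 -> lin l d = 0.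
  (* [d] is the direction of the tight side *)
  pose T := [seq l <- undup S | aff l (c i) == 0].
  have inT l : l \in S -> aff l (c i) = 0 -> l \in T.
    by move=> lS /eqP z; rewrite mem_filter z mem_undup.
  move: one; rewrite -size_filter -/T; case: T inT => [|l0 [|//]] inT _.
    exists (const_mx 1) => [|l lS /(inT l lS)//].
    by apply/eqP => /matrixP/(_ 0 0); rewrite !mxE; apply/eqP/oner_neq0.
  have [l0S|l0S] := boolP (l0 \in S); last first.
    exists (const_mx 1) => [|l lS /(inT l lS)]; last by rewrite inE => /eqP e; rewrite -e lS in l0S.
    by apply/eqP => /matrixP/(_ 0 0); rewrite !mxE; apply/eqP/oner_neq0.
  exists (\row_(j < 2) if j == 0 then - l0.1.2 else l0.1.1).
    apply/eqP => /matrixP E; have := E 0 0; have := E 0 1; rewrite !mxE /= => e1 /eqP.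
    by rewrite oppr_eq0 => e2; have := S0 l0S; rewrite e1 e2 eqxx.
  move=> l lS /(inT l lS); rewrite inE => /eqP ->.
  by rewrite /lin !mxE /=; ring.
have [e e0 eS] := slack ci_ge0 dS.
have inD s : `|s| = e -> (weighted_sum c @` @simplex R k) (c i + s *: d).
  (* points on the way to [q] satisfy all constraints strictly *)
  move=> se; apply: (@closed_limit R _ _ q (@simplex_image_closed R k c)).
  move=> t /andP[t0 t1]; apply: sub_simplex_image; apply: interior_subset.
  rewrite -FE => l lS; rewrite aff_conv.
  have aS : 0 <= aff l (c i + s *: d).
    rewrite aff_move; have := eS l lS; have := ler_norm (- (s * lin l d)).
    by rewrite normrN normrM se; lra.
  by rewrite ltr_wpDl ?mulr_ge0 ?subr_ge0// mulr_gt0// Sq.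
have := corner_extreme cP (inD e _); rewrite gtr0_norm// => /(_ erefl).
have := inD (- e); rewrite normrN gtr0_norm// scaleNr => /(_ erefl) h /(_ h) /eqP.
by rewrite scaler_eq0 (negbTE d0) gt_eqF.
Qed.

(** Double counting of incidences between corners and sides. *)
Lemma corners_le_sides : (k <= size S)%N.
Proof.
apply: leq_trans (size_undup S).
rewrite -(leq_pmul2l (isT : (0 < 2)%N)).
have : (\sum_(i < k) 2 <= \sum_(i < k) \sum_(l <- undup S) (aff l (c i) == 0%R))%N.
  apply: leq_sum => i _; apply: leq_trans (two_sides_at_corner i) _.
  by rewrite -sum1_count big_mkcond.
rewrite sum_nat_const card_ord mulnC => /leq_trans; apply.
rewrite exchange_big /=.
have -> : (2 * size (undup S) = \sum_(l <- undup S) 2)%N.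
  by rewrite big_const_seq count_predT iter_addn_0.
rewrite [leqLHS]big_seq [leqRHS]big_seq; apply: leq_sum => l; rewrite mem_undup => lS.
apply: leq_trans (corners_on_line cP (S0 lS)).
by rewrite -sum1_card [leqRHS]big_mkcond /=; apply: leq_sum => i _; rewrite inE.
Qed.

End Polygon.
End PolygonCorners.

(** * Cells of line arrangements and faces of drawings *)

Section PlaneFaces.
Variable R : realType.
Local Notation V := ('rV[R]_2).
Implicit Types (x y z q d : V) (t : R) (A : set V).

Lemma halfplane_convex (l : R * R * R) : convex_set [set z : V | 0 < aff l z].
Proof.
apply/convex_setE => x y t /= ax ay /andP[t0 t1]; rewrite aff_conv.
have [->|t_neq0] := eqVneq t 0; first by rewrite subr0 mul1r mul0r addr0.
by rewrite ltr_wpDl ?mulr_ge0 ?subr_ge0 ?(ltW ax)// mulr_gt0// lt0r t_neq0.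
Qed.

Lemma closed_halfplane_convex (l : R * R * R) : convex_set [set z : V | 0 <= aff l z].
Proof.
apply/convex_setE => x y t /= ax ay /andP[t0 t1]; rewrite aff_conv.
by rewrite addr_ge0 ?mulr_ge0 ?subr_ge0.
Qed.

Lemma aff_continuous (l : R * R * R) : continuous (@aff R l).
Proof.
move=> z; apply: cvgD; [exact: (nbhs_filter z)| |apply: cvg_cst; exact: (nbhs_filter z)].
apply: cvgD; first exact: (nbhs_filter z).
  apply: cvgM; first exact: (nbhs_filter z); last exact: coord_continuous.
  by apply: cvg_cst; exact: (nbhs_filter z).
apply: cvgM; first exact: (nbhs_filter z); last exact: coord_continuous.
by apply: cvg_cst; exact: (nbhs_filter z).
Qed.

Definition normal (l : R * R * R) : V := \row_(j < 2) if j == 0 then l.1.1 else l.1.2.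

Lemma lin_normal (l : R * R * R) : (l.1.1 != 0) || (l.1.2 != 0) -> 0 < lin l (normal l).
Proof.
move=> l0; rewrite /lin !mxE /= -!expr2 lt0r paddr_eq0 ?sqr_ge0// !sqrf_eq0 negb_and l0.
by rewrite addr_ge0 ?sqr_ge0.
Qed.

(** Removing a line from a non-empty open set leaves a non-empty open set. *)
Lemma generic_point A (L : seq (R * R * R)) : open A -> A !=set0 ->
    (forall l, l \in L -> (l.1.1 != 0) || (l.1.2 != 0)) ->
  exists2 q, A q & forall l, l \in L -> aff l q != 0.
Proof.
elim: L A => [|l L IH] A oA [z Az] nz; first by exists z.
have [|||q [Aq lq] Lq] := IH (A `&` [set z | aff l z != 0]).
- apply: openI => //.
  rewrite (_ : [set z | _] = ~` (aff l @^-1` [set 0])).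
    apply: closed_openC; apply: preimage_closed; last exact: closed_eq.
    by move=> w _; exact: aff_continuous.
  by apply/seteqP; split=> w /= /eqP.
- have [lz|lz] := eqVneq (aff l z) 0; last by exists z.
  have [none|/existsNP[t /not_implyP[/andP[t0 t1] /contrapT At]]] :=
      pselect (forall t, 0 < t <= 1 -> (~` A) ((1 - t) *: z + t *: (z + normal l))).
    by case: (closed_limit (open_closedC oA) none).
  exists ((1 - t) *: z + t *: (z + normal l)); split=> //=.
  have := aff_move l z (normal l) 1; rewrite scale1r mul1r => lE.
  rewrite aff_conv lE lz mulr0 !add0r mulf_neq0 ?gt_eqF//.
  by apply: lin_normal; apply: nz; rewrite mem_head.
- by move=> l' l'L; apply: nz; rewrite inE l'L orbT.
- by exists q => // l'; rewrite inE => /predU1P[->|/Lq].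
Qed.

(** The alternative [t = 1] covers the segments that stay in the closed cell up
    to their end. *)
Lemma first_exit (L : seq (R * R * R)) q z : (forall l, l \in L -> 0 < aff l q) ->
  exists t, [/\ 0 <= t <= 1, forall l, l \in L -> 0 <= aff l ((1 - t) *: q + t *: z) &
    t = 1 \/ exists2 l, l \in L & aff l ((1 - t) *: q + t *: z) = 0].
Proof.
elim: L => [|l L IH] Lq; first by exists 1; rewrite lexx ler01; split=> //; left.
have [|t [/andP[t0 t1] tL tE]] := IH; first by move=> l' l'L; apply: Lq; rewrite inE l'L orbT.
have [ge|lt] := lerP 0 (aff l ((1 - t) *: q + t *: z)).
  exists t; split; first by rewrite t0.
    by move=> l'; rewrite inE => /predU1P[->|/tL].
  by case: tE => [->|[l' l'L l'0]]; [left|right; exists l'; rewrite ?inE ?l'L ?orbT].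
have lq := Lq l (mem_head _ _).
set y := (1 - t) *: q + t *: z in lt tL.
have dpos : 0 < aff l q - aff l y by lra.
pose s := aff l q / (aff l q - aff l y).
have s0 : 0 <= s by rewrite divr_ge0// ltW.
have s1 : s <= 1 by rewrite ler_pdivrMr// mul1r; lra.
have yE : (1 - s * t) *: q + (s * t) *: z = (1 - s) *: q + s *: y.
  by apply: plane_eq; rewrite /y !mxE; ring.
have l0 : aff l ((1 - s) *: q + s *: y) = 0.
  by rewrite aff_conv /s; field; rewrite gt_eqF.
exists (s * t); rewrite yE; split; first by rewrite mulr_ge0// mulr_ile1.
  move=> l'; rewrite inE => /predU1P[->|l'L]; first by rewrite l0.
  rewrite aff_conv addr_ge0// mulr_ge0 ?subr_ge0 ?tL//.
  by rewrite ltW// Lq// inE l'L orbT.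
by right; exists l; rewrite ?mem_head.
Qed.

(** A set that is star-shaped around [q] and meets the closed cell only in the
    open cell cannot leave the cell, as a segment from [q] would exit through a
    boundary point. *)
Lemma star_in_cell (L : seq (R * R * R)) q A : (forall l, l \in L -> 0 < aff l q) ->
    (forall z t, A z -> 0 <= t <= 1 -> A ((1 - t) *: q + t *: z)) ->
    (forall y, A y -> (forall l, l \in L -> 0 <= aff l y) ->
      forall l, l \in L -> aff l y <> 0) ->
  A `<=` [set z | forall l, l \in L -> 0 < aff l z].
Proof.
move=> Lq star noexit z Az l lL.
have [t [t01 tL tE]] := first_exit z Lq.
case: tE => [t1|[l' l'L l'0]]; last by case: (noexit _ (star z t Az t01) tL l' l'L l'0).
move: tL; rewrite t1 subrr scale0r add0r scale1r => tL.
by rewrite lt_neqAle tL// andbT eq_sym; apply/eqP; apply: noexit.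
Qed.

Lemma convex_in_component A B q : convex_set A -> A q -> A `<=` B ->
  A `<=` connected_component B q.
Proof.
move=> /convex_setE cA Aq AB y Ay.
pose g (t : R) : V := (1 - t) *: q + t *: y.
have cg : continuous g.
  have -> : g = (fun t => q + t *: (y - q)).
    by apply/funext => t; apply: plane_eq; rewrite !mxE; ring.
  move=> t; apply: cvgD; first exact: cvg_cst.
  by apply: cvgZr_tmp; exact: cvg_id.
have : connected (g @` `[0, 1]).
  apply: connected_continuous_connected; first exact: segment_connected.
  exact: continuous_subspaceT.
have gq : (g @` `[0, 1]) q.
  by exists 0; rewrite /= ?in_itv /= ?lexx ?ler01// /g subr0 scale1r scale0r addr0.
have gB : g @` `[0, 1] `<=` B.
  by move=> _ [t + <-]; rewrite /= in_itv /= => t01; apply: AB; apply: cA.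
move=> /(connected_component_max gq gB); apply.
by exists 1; rewrite /= ?in_itv /= ?lexx ?ler01// /g subrr scale0r add0r scale1r.
Qed.

Lemma bounded_no_ray A q d : bounded_set A -> d != 0 ->
  ~ forall t, 0 <= t -> A (q + t *: d).
Proof.
move=> [M [_ Mb]] d0 ray.
have nd : 0 < `|d| by rewrite normr_gt0.
have M1 : M < `|M| + 1 by rewrite (le_lt_trans (ler_norm M))// ltrDl.
pose s := (`|M| + 1 + `|q| + 1) / `|d|.
have s0 : 0 <= s by rewrite divr_ge0// !addr_ge0.
have sd : `|s *: d| = `|M| + 1 + `|q| + 1.
  by rewrite normrZ (ger0_norm s0) divfK ?gt_eqF.
have := Mb _ M1 _ (ray s s0); rewrite /= addrC.
by have := lerB_normD (s *: d) q; rewrite sd; lra.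
Qed.

Section Drawing.
Variables (n : nat) (p : 'I_n -> V).

Lemma drawing_sub A : convex_set A -> (forall i, A (p i)) -> drawing_set p `<=` A.
Proof.
move=> /convex_setE cA pA z [[i _ <-]//|[e _ [t + <-]]].
by rewrite /= in_itv /= => t01; apply: cA.
Qed.

(** A half-plane that avoids the drawing is connected and contains rays. *)
Lemma face_halfplane q (l : R * R * R) : (l.1.1 != 0) || (l.1.2 != 0) ->
    bounded_set (connected_component (~` drawing_set p) q) ->
    (forall i, aff l (p i) <= 0) -> aff l q <= 0.
Proof.
move=> l0 bF pl; rewrite leNgt; apply/negP => lq.
have HF : [set z | 0 < aff l z] `<=` connected_component (~` drawing_set p) q.
  apply: convex_in_component => //; first exact: halfplane_convex.
  move=> z lz; pose l' := (- l.1.1, - l.1.2, - l.2).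
  have l'E u : aff l' u = - aff l u by rewrite /aff /lin /=; ring.
  move=> /(@drawing_sub [set z | 0 <= aff l' z] (@closed_halfplane_convex l')) /= D.
  have : 0 <= aff l' z by apply: D => i; rewrite l'E oppr_ge0.
  by rewrite l'E; have /= := lz; lra.
have ln := lin_normal l0.
have n0 : normal l != 0.
  by apply/eqP => e; move: ln; rewrite e /lin !mxE !mulr0 addr0 ltxx.
apply: (bounded_no_ray (q := q) bF n0) => t t0; apply: HF => /=.
by rewrite aff_move ltr_wpDr// mulr_ge0// ltW.
Qed.

End Drawing.
End PlaneFaces.

(** * The drawing on the parabola *)

Section ParabolaDrawing.
Variables (R : realType) (N : nat).
Local Notation V := ('rV[R]_2).
Implicit Types (x y z q : V) (t : R).

Definition parabola_point (i : nat) : V := \row_(j < 2) pow2 R i ^+ j.+1.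

Definition parabola_points (i : 'I_N.+1) : V := parabola_point i.

(** For [i = j] this is the tangent, which keeps the family of lines indexed by
    all pairs. *)
Definition chord (i j : nat) : R * R * R := (- (pow2 R i + pow2 R j), 1, pow2 R i * pow2 R j).

Lemma chord_neq0 i j : ((chord i j).1.1 != 0) || ((chord i j).1.2 != 0).
Proof. by rewrite /= oner_neq0 orbT. Qed.

Lemma aff_chord i j z : aff (chord i j) z = gap i j (z 0 0) (z 0 1 - z 0 0 ^+ 2).
Proof. by rewrite /aff /lin /gap /=; ring. Qed.

Lemma aff_chord_point i j k : aff (chord i j) (parabola_point k) =
  (pow2 R k - pow2 R i) * (pow2 R k - pow2 R j).
Proof. by rewrite /aff /lin !mxE /=; ring. Qed.

Lemma pow2_inj : injective (pow2 R).
Proof. by move=> i j e; apply/eqP; rewrite eqn_leq -!(pow2_le R) e lexx. Qed.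

Lemma aff_chord_segment i j t z :
    z = (1 - t) *: parabola_point i + t *: parabola_point j ->
  aff (chord i j) z = 0.
Proof. by move=> ->; rewrite aff_conv !aff_chord_point; ring. Qed.

Lemma segment_abscissa i j t z :
    z = (1 - t) *: parabola_point i + t *: parabola_point j ->
  z 0 0 = pow2 R i + t * (pow2 R j - pow2 R i).
Proof. by move=> ->; rewrite !mxE !expr1; ring. Qed.

Local Notation p := parabola_points.

Lemma parabola_rectilinear : rectilinear_drawing p.
Proof.
split=> [i j /matrixP/(_ 0 0)|i j k ij jk ik [x [d [d0 [s _ si] [t _ tj] [u _ uk]]]]].
  by rewrite !mxE !expr1 => /pow2_inj/val_inj.
have ne (a b : 'I_N.+1) : a != b -> pow2 R a != pow2 R b.
  by apply: contra_neq => /pow2_inj/val_inj.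
have E v : aff (chord i j) (x + v *: d) = aff (chord i j) x + v * lin (chord i j) d.
  exact: aff_move.
have := E s; have := E t; have := E u; rewrite si tj uk !aff_chord_point !subrr mulr0 mul0r.
set a := aff _ _; set b := lin _ _ => eu et es.
have st : s != t.
  apply: contra_neq ij => e; apply: val_inj; apply: pow2_inj.
  by have /matrixP/(_ 0 0) : p i = p j by [rewrite -si -tj e]; rewrite !mxE !expr1.
have b0 : b = 0.
  apply/eqP; have /eqP : (s - t) * b = 0 by lra.
  by rewrite mulf_eq0 subr_eq0 (negbTE st).
move: eu; rewrite b0 mulr0 addr0.
have -> : a = 0 by move: es; rewrite b0; lra.
by move/eqP; rewrite mulf_eq0 !subr_eq0 [_ == pow2 R i]eq_sym [_ == pow2 R j]eq_sym
  (negbTE (ne _ _ ik)) (negbTE (ne _ _ jk)).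
Qed.

(** The tangent [chord i i] has all the other points strictly above it. *)
Lemma parabola_convex_position : convex_position p.
Proof.
move=> i hull.
suff : 0 < aff (chord i i) (p i) by rewrite aff_chord_point subrr mul0r ltxx.
move: hull; apply: (smallest_sub (X := [set z | 0 < aff (chord i i) z])).
  exact: halfplane_convex.
move=> _ [j ji <-] /=; rewrite aff_chord_point -expr2 lt0r sqr_ge0 sqrf_eq0 subr_eq0 andbT.
by apply: contra_neq ji => /pow2_inj/val_inj.
Qed.

(** Chords through a common interior point are totally ordered by their left
    ends, and their right ends come in the same order ([nest]); of three such
    chords the first two violate [doubling_lt] ([chain]). *)
Lemma parabola_generic : generic p.
Proof.
move=> z [E [sE /card_gt2P[e [f [g [[eE fE gE] [ef fg ge]]]]] cross]].
have on a b : a \in E -> b \in E -> a != b ->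
    [/\ pow2 R a.1 < z 0 0, z 0 0 < pow2 R a.2 & gap a.1 a.2 (z 0 0) (z 0 1 - z 0 0 ^+ 2) = 0].
  move=> aE bE ab; have [[t /= + zE] _ _] := cross a b aE bE ab.
  rewrite in_itv /= => /andP[t0 t1].
  have := fintype.subsetP sE _ aE; rewrite inE -(pow2_lt R) => lt.
  rewrite -aff_chord (aff_chord_segment (esym zE)) (segment_abscissa (esym zE)).
  have tp : 0 < t * (pow2 R a.2 - pow2 R a.1) by rewrite mulr_gt0// subr_gt0.
  have tp1 : 0 < (1 - t) * (pow2 R a.2 - pow2 R a.1) by rewrite mulr_gt0 ?subr_gt0.
  by split=> //; lra.
set a := z 0 0 in on *; set h := z 0 1 - _ in on *.
have nest u v : u \in E -> v \in E -> u != v -> ~~ ((u.1 <= v.1)%N && (v.2 <= u.2)%N).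
  move=> uE vE uv; apply/negP; rewrite -!(pow2_le R) => /andP[le1 le2].
  have [u1 u2 u0] := on u v uE vE uv; have [v1 v2 v0] := on v u vE uE ltac:(by rewrite eq_sym).
  have r1 : 0 <= (a - pow2 R v.1) * (pow2 R u.2 - pow2 R v.2) by rewrite mulr_ge0; lra.
  have r2 : 0 <= (pow2 R v.1 - pow2 R u.1) * (pow2 R v.2 - a) by rewrite mulr_ge0; lra.
  have r3 : 0 <= (pow2 R v.1 - pow2 R u.1) * (pow2 R u.2 - pow2 R v.2) by rewrite mulr_ge0; lra.
  move: u0 v0; rewrite /gap => u0 v0.
  have /eqP : (a - pow2 R v.1) * (pow2 R u.2 - pow2 R v.2) = 0 by lra.
  have /eqP : (pow2 R v.1 - pow2 R u.1) * (pow2 R v.2 - a) = 0 by lra.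
  rewrite !mulf_eq0 => /orP[|/eqP]; last lra.
  rewrite subr_eq0 => /eqP/pow2_inj/val_inj e1 /orP[/eqP|]; first lra.
  rewrite subr_eq0 => /eqP/pow2_inj/val_inj e2.
  by case/negP: uv; rewrite -pair_eqE /= /pair_eq e1 e2 !eqxx.
have chain u v w : u \in E -> v \in E -> w \in E -> u != v -> v != w ->
    ~~ ((u.1 < v.1)%N && (v.1 < w.1)%N && (u.2 < v.2)%N).
  move=> uE vE wE uv vw; apply/negP => /andP[lt1 lt2].
  have [u1 u2 u0] := on u v uE vE uv; have [v1 v2 v0] := on v w vE wE vw.
  have [w1 _ _] := on w v wE vE ltac:(by rewrite eq_sym).
  have := doubling_lt lt1 lt2 (ltW w1) u2; move: u0 v0; rewrite /gap; lra.
have [fe gf eg] : [/\ f != e, g != f & e != g] by rewrite eq_sym ef eq_sym fg eq_sym ge.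
have := nest _ _ eE fE ef; have := nest _ _ fE eE fe.
have := nest _ _ fE gE fg; have := nest _ _ gE fE gf.
have := nest _ _ gE eE ge; have := nest _ _ eE gE eg.
have := chain _ _ _ eE fE gE ef fg; have := chain _ _ _ eE gE fE eg gf.
have := chain _ _ _ fE eE gE fe eg; have := chain _ _ _ fE gE eE fg ge.
have := chain _ _ _ gE eE fE ge ef; have := chain _ _ _ gE fE eE gf fe.
clear; lia.
Qed.

(** Above the parabola, a line through two of the points carries nothing but the
    edge between them. *)
Lemma gap_on_drawing i j y : (i <= N)%N -> (j <= N)%N -> 0 <= y 0 1 - y 0 0 ^+ 2 ->
  gap i j (y 0 0) (y 0 1 - y 0 0 ^+ 2) = 0 -> drawing_set p y.
Proof.
wlog ij : i j / (i <= j)%N => [WL|] iN jN h0 z.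
  by have [ij|/ltnW ji] := leqP i j; [apply: (WL i j)|apply: (WL j i) => //; rewrite gapC].
have /andP[yi yj] := on_chord ij h0 z.
move: z; rewrite -aff_chord /aff /lin /= => z.
move: ij; rewrite leq_eqVlt => /predU1P[e|lt].
  left; exists (inord i) => //; rewrite /parabola_points inordK //.
  have y0 : y 0 0 = pow2 R i by apply/eqP; rewrite eq_le yi e yj.
  by apply: plane_eq; rewrite !mxE ?expr1 //; move: z; rewrite -e y0; lra.
right; exists (inord i, inord j); first by rewrite /= inE /= !inordK.
have d0 : 0 < pow2 R j - pow2 R i by rewrite subr_gt0 pow2_lt.
exists ((y 0 0 - pow2 R i) / (pow2 R j - pow2 R i)).
  rewrite /= in_itv /= divr_ge0 ?(ltW d0) ?subr_ge0//=.
  by rewrite ler_pdivrMr// mul1r; lra.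
rewrite /= /parabola_points !inordK //.
have dn : pow2 R j - pow2 R i != 0 by rewrite gt_eqF.
apply: plane_eq; rewrite !mxE /= ?expr1; first by field.
have -> : y 0 1 = (pow2 R i + pow2 R j) * y 0 0 - pow2 R i * pow2 R j by lra.
by field.
Qed.

(** On each of the tested lines the drawing lies on one side, so a point beyond
    it would lie in an unbounded face. *)
Lemma bounded_face_inside q :
    bounded_set (connected_component (~` drawing_set p) q) ->
    (forall i j, (i <= N)%N -> (j <= N)%N -> aff (chord i j) q != 0) ->
    (forall i, (i <= N)%N -> q 0 0 != pow2 R i) ->
  [/\ pow2 R 0 < q 0 0 < pow2 R N, aff (chord 0 N) q < 0 &
      forall i, (i < N)%N -> 0 < aff (chord i i.+1) q].
Proof.
move=> bF ne nev.
have outside (l : R * R * R) : (l.1.1 != 0) || (l.1.2 != 0) ->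
    (forall i, (i <= N)%N -> aff l (parabola_point i) <= 0) -> aff l q <= 0.
  move=> l0 pl; apply: (@face_halfplane R _ p) => // i.
  by apply: pl; rewrite -ltnS.
split.
- apply/andP; split; rewrite lt_neqAle.
    rewrite eq_sym nev//=.
    have := outside (-1, 0, pow2 R 0).
    rewrite /aff /lin /= oppr_eq0 oner_neq0 => /(_ isT) H.
    have : -1 * q 0 0 + 0 * q 0 1 + pow2 R 0 <= 0; last by lra.
    by apply: H => i _; have := leq0n i; rewrite !mxE /= -(pow2_le R); lra.
  rewrite nev//=.
  have := outside (1, 0, - pow2 R N); rewrite /aff /lin /= oner_neq0 => /(_ isT) H.
  have : 1 * q 0 0 + 0 * q 0 1 - pow2 R N <= 0; last by lra.
  by apply: H => i; rewrite -(pow2_le R) !mxE /=; lra.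
- rewrite lt_neqAle ne//=; apply: outside; first exact: chord_neq0.
  by move=> i iN; rewrite aff_chord_point mulr_ge0_le0 ?subr_ge0 ?subr_le0 ?pow2_le.
- move=> i iN; rewrite lt_neqAle eq_sym ne//=; last exact: ltnW.
  pose l : R * R * R := (- (chord i i.+1).1.1, - (chord i i.+1).1.2, - (chord i i.+1).2).
  have lE z : aff l z = - aff (chord i i.+1) z by rewrite /aff /lin /=; ring.
  rewrite -oppr_le0 -lE; apply: outside; first by rewrite /= !oppr_eq0 oner_neq0 orbT.
  move=> j jN; rewrite lE oppr_le0 aff_chord_point.
  have [ji|ij] := leqP j i; first by rewrite mulr_le0// subr_le0 pow2_le// ltnW.
  by rewrite mulr_ge0// subr_ge0 pow2_le// ltnW.
Qed.

(** The line through points [e.1] and [e.2], scaled so that its positive side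
    is the side of [q]. *)
Definition side q (e : nat * nat) : R * R * R :=
  let l := chord e.1 e.2 in let g := aff l q in (g * l.1.1, g * l.1.2, g * l.2).

Lemma aff_side q e z : aff (side q e) z = aff (chord e.1 e.2) q * aff (chord e.1 e.2) z.
Proof. by rewrite {1}/aff {1}/lin /side /= [X in _ = _ * X]/aff /lin /=; ring. Qed.

Definition all_sides q : seq (R * R * R) :=
  [seq side q e | e <- [seq (i, j) | i <- iota 0 N.+1, j <- iota 0 N.+1]].

Lemma mem_all_sides q i j : (i <= N)%N -> (j <= N)%N -> side q (i, j) \in all_sides q.
Proof.
move=> iN jN; apply: map_f; apply/allpairsP; exists (i, j).
by rewrite !mem_iota /= !add0n !ltnS.
Qed.

Lemma all_sidesP q l : l \in all_sides q ->
  exists i j, [/\ (i <= N)%N, (j <= N)%N & l = side q (i, j)].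
Proof.
move=> /mapP[_ /allpairsP[[i j] [iN jN ->]] ->]; exists i, j.
by move: iN jN; rewrite !mem_iota /= !add0n !ltnS.
Qed.

Definition cell q : set V := [set z | forall l, l \in all_sides q -> 0 < aff l z].

Section Cell.
Variable q : V.
Hypothesis ne : forall i j, (i <= N)%N -> (j <= N)%N -> aff (chord i j) q != 0.
Hypothesis top : aff (chord 0 N) q < 0.
Hypothesis bottom : forall i, (i < N)%N -> 0 < aff (chord i i.+1) q.

Lemma side_gt0 e : (e.1 <= N)%N && (e.2 <= N)%N -> 0 < aff (side q e) q.
Proof. by move=> /andP[iN jN]; rewrite aff_side -expr2 lt0r sqr_ge0 sqrf_eq0 ne. Qed.

Lemma all_sides_gt0 l : l \in all_sides q -> 0 < aff l q.
Proof. by move=> /all_sidesP[i [j [iN jN ->]]]; apply: side_gt0; rewrite iN. Qed.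

Lemma closed_cell y : (0 < N)%N -> (forall l, l \in all_sides q -> 0 <= aff l y) ->
  same_side N (q 0 0) (q 0 1 - q 0 0 ^+ 2) (y 0 0) (y 0 1 - y 0 0 ^+ 2) /\
  0 <= y 0 1 - y 0 0 ^+ 2.
Proof.
move=> N0 yL; split=> [i j iN jN|].
  by have := yL _ (mem_all_sides q iN jN); rewrite aff_side !aff_chord.
(* a single edge would be both the top and the bottom of the polygon *)
have N1 : (1 < N)%N.
  rewrite ltn_neqAle N0 andbT; apply/eqP => e1.
  by have := bottom N0; move: top; rewrite -e1; lra.
apply: (above_parabola (b := y 0 0) N1) => [i iN|]; rewrite -aff_chord.
  by have := yL _ (mem_all_sides q (ltnW iN) iN); rewrite aff_side pmulr_rge0 ?bottom.
by have := yL _ (mem_all_sides q (leq0n _) (leqnn _)); rewrite aff_side nmulr_rge0.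
Qed.

Lemma side_eq0 i j y : (i <= N)%N -> (j <= N)%N -> aff (side q (i, j)) y = 0 ->
  gap i j (y 0 0) (y 0 1 - y 0 0 ^+ 2) = 0.
Proof.
move=> iN jN /eqP; rewrite aff_side mulf_eq0 => /orP[|/eqP]; last by rewrite aff_chord.
by rewrite (negbTE (ne _ _)).
Qed.

(** To leave the cell from [q] inside the sides in [S], a segment would have to
    cross a line at a boundary point of the cell, hence also a line of [S]. *)
Lemma sides_sub_cell (S : seq (nat * nat)) : (0 < N)%N ->
    (forall e, e \in S -> (e.1 <= N)%N && (e.2 <= N)%N) ->
    (forall b k, 0 <= k -> same_side N (q 0 0) (q 0 1 - q 0 0 ^+ 2) b k ->
      forall i j, (i <= N)%N -> (j <= N)%N -> gap i j b k = 0 ->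
      exists2 e, e \in S & gap e.1 e.2 b k = 0) ->
  [set z | forall l, l \in map (side q) S -> 0 < aff l z] `<=` cell q.
Proof.
move=> N0 SN cover; apply: (star_in_cell all_sides_gt0).
  move=> z t /= zS /andP[t0 t1] l lS; rewrite aff_conv.
  have lq : 0 < aff l q by move/mapP: lS => [e eS ->]; exact/side_gt0/SN.
  have := zS l lS; move: t0; rewrite le_eqVlt => /predU1P[<-|t0] lz.
    by rewrite subr0 mul1r mul0r addr0.
  by rewrite ltr_wpDl ?mulr_gt0// mulr_ge0 ?subr_ge0// ltW.
move=> y /= yS yL _ /all_sidesP[i [j [iN jN ->]]] z0.
have [ss y0] := closed_cell N0 yL.
have [e eS e0] := cover _ _ y0 ss i j iN jN (side_eq0 iN jN z0).
by have := yS _ (map_f (side q) eS); rewrite aff_side [X in _ * X]aff_chord e0 mulr0 ltxx.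
Qed.

Lemma cell_sub_face : cell q `<=` connected_component (~` drawing_set p) q.
Proof.
apply: convex_in_component; last 1 first.
- move=> z zL [[i _ iz]|[[i j] _ [t _ tz]]].
    have iN : (i <= N)%N by rewrite -ltnS.
    have := zL _ (mem_all_sides q iN iN).
    by rewrite aff_side -iz aff_chord_point subrr mul0r mulr0 ltxx.
  have [iN jN] : (i <= N)%N /\ (j <= N)%N by split; rewrite -ltnS.
  have := zL _ (mem_all_sides q iN jN).
  by rewrite aff_side (aff_chord_segment (esym tz)) mulr0 ltxx.
- apply/convex_setE => x y t /= xL yL t01 l lL.
  by move/convex_setE: (@halfplane_convex R l); apply => //=; [exact: xL|exact: yL].
- exact: all_sides_gt0.
Qed.

(** Inside the polygon a line between two of the points is an edge of the
    drawing, so a face that is star-shaped around [q] crosses no line. *)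
Lemma star_face_sub_cell (F : set V) : (0 < N)%N -> F `<=` ~` drawing_set p ->
    (forall z t, F z -> 0 <= t <= 1 -> F ((1 - t) *: q + t *: z)) ->
  F `<=` cell q.
Proof.
move=> N0 FD star; apply: (star_in_cell all_sides_gt0) => // y Fy yL.
move=> _ /all_sidesP[i [j [iN jN ->]]] z0.
have [_ y0] := closed_cell N0 yL.
by case: (FD y Fy); apply: gap_on_drawing iN jN y0 (side_eq0 iN jN z0).
Qed.

End Cell.

(** The face is the cell around a generic point of it; five of the lines
    already bound that cell. *)
Lemma face_corners_le5 k F : is_kface p k F -> (k <= 5)%N.
Proof.
move=> [[q0 Dq0 F0] bF [c cP FE]].
have oF : open F by rewrite FE; exact: open_interior.
(* a point of the face off all lines through two points and off the verticals *)
pose lines := [seq chord i j | i <- iota 0 N.+1, j <- iota 0 N.+1] ++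
  [seq (1, 0, - pow2 R i) | i <- iota 0 N.+1].
have [||q Fq qL] := @generic_point R F lines oF.
- by exists q0; rewrite F0; exact: connected_component_refl.
- move=> l; rewrite mem_cat => /orP[/allpairsP[[i j] [_ _ ->]]|/mapP[i _ ->]].
    exact: chord_neq0.
  by rewrite /= oner_neq0.
have Fcomp : F = connected_component (~` drawing_set p) q.
  by rewrite F0; apply: same_connected_component; rewrite -F0; exact: Fq.
have ne i j : (i <= N)%N -> (j <= N)%N -> aff (chord i j) q != 0.
  move=> iN jN; apply: qL; rewrite mem_cat; apply/orP; left.
  by apply/allpairsP; exists (i, j); rewrite !mem_iota /= !add0n !ltnS.
have nev i : (i <= N)%N -> q 0 0 != pow2 R i.
  move=> iN; have : aff (1, 0, - pow2 R i) q != 0.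
    by apply: qL; rewrite mem_cat; apply/orP; right; apply: map_f; rewrite mem_iota.
  by apply: contra_neq => qi; rewrite /aff /lin /= qi; ring.
have [qx top bottom] : [/\ pow2 R 0 < q 0 0 < pow2 R N, aff (chord 0 N) q < 0 &
    forall i, (i < N)%N -> 0 < aff (chord i i.+1) q].
  by apply: bounded_face_inside => //; rewrite -Fcomp.
have N0 : (0 < N)%N by rewrite -(pow2_lt R); case/andP: qx; exact: lt_trans.
have [m mN mq] := strip qx nev.
set a := q 0 0 in mq; pose h := q 0 1 - a ^+ 2.
have gapq i j : gap i j a h = aff (chord i j) q by rewrite aff_chord.
have h0 : 0 < h.
  have := bottom m mN; rewrite -gapq /gap; have /andP[m1 m2] := mq.
  have : 0 < (a - pow2 R m) * (pow2 R m.+1 - a) by rewrite mulr_gt0 ?subr_gt0.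
  lra.
have [||S [S5 SN cover]] := @five_chords R N m a h mN mq h0; rewrite ?gapq//.
  by move=> i j iN jN; rewrite gapq ne.
have FS : [set z | forall l, l \in map (side q) S -> 0 < aff l z] = F.
  apply/seteqP; split.
    rewrite Fcomp; apply: subset_trans (cell_sub_face ne).
    exact: sides_sub_cell.
  apply: (@subset_trans _ (cell q)); last first.
    by move=> z zL l /mapP[[i j] /SN /= /andP[iN jN] ->]; apply: zL; exact: mem_all_sides.
  apply: star_face_sub_cell => //; first by rewrite Fcomp; exact: connected_component_sub.
  move=> z t Fz /andP[]; rewrite le_eqVlt => /predU1P[<- _|t0 t1].
    by rewrite subr0 scale1r scale0r addr0.
  move: Fz Fq; rewrite FE => Fz /interior_subset Hq.
  by apply: interior_convex_step => //; [exact: convex_hull_convex|rewrite t0].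
apply: leq_trans S5; rewrite -(size_map (side q)).
apply: (@corners_le_sides R k c _ q cP); first by rewrite FS FE.
  by move=> _ /mapP[e /SN /andP[iN jN] ->]; rewrite /= mulr1 ne// orbT.
by move=> _ /mapP[e eS ->]; exact/(side_gt0 ne)/SN.
Qed.

End ParabolaDrawing.

Theorem theorem3 (R : realType) (n : nat) (n_gt0 : (0 < n)%N) :
  exists p : 'I_n -> 'rV[R]_2,
    [/\ rectilinear_drawing p, convex_position p, generic p &
        forall (k : nat) (F : set 'rV[R]_2), (6 <= k)%N -> ~ is_kface p k F].
Proof.
case: n n_gt0 => // N _; exists (@parabola_points R N); split.
- exact: parabola_rectilinear.
- exact: parabola_convex_position.
- exact: parabola_generic.
- by move=> k F k6 /face_corners_le5; rewrite leqNgt k6.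
Qed.
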